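(* For each Cantor set $K \subset \mathbb{R}$ and each finite (rooted) tree $T$, there exists a Cantor set $\widetilde{K} \subset \mathbb{R}$ such that $\left( \Delta^T_{y} (K \times \widetilde{K} ) \right)^\circ \neq \varnothing$ for some $y\in K\times \widetilde{K}$, where the interior is taken in $\mathbb{R}^{m-1}$ with $m$ the number of vertices of $T$.
   Context: A Cantor set is a subset of $\mathbb{R}^d$ that is compact, totally disconnected, and perfect. $|\cdot|$ of a vector is the Euclidean norm, and $(\cdot)^\circ$ denotes the interior. A tree is a connected acyclic graph; a finite tree is a tree whose vertex set is finite. Each tree $T$ carries a designated root, labeled $0$; write $\tau\in T$ for a vertex of $T$ and $\tau\sim\sigma$ when $\tau,\sigma$ are joined by an edge. If $T$ has $m$ vertices (hence $m-1$ edges), then for $X\subset\mathbb{R}^2$ and a pin $y\in X$, the pinned tree distance set is $$\Delta^T_y (X) = \{ (|y^\tau-y^\sigma|)_{\tau\sim \sigma}: \{y^\tau\}_{\tau \in T} \text{ is a set of distinct points in } X,\ y^0=y\}\subset\mathbb{R}^{m-1},$$ with one coordinate for each edge of $T$, the edges being listed in a fixed order (whether the interior is nonempty does not depend on the order). *)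

(* Defs.v *)
From HB Require Import structures.
From mathcomp Require Import all_boot all_order all_algebra.
From mathcomp Require Import all_classical all_reals all_analysis.

Set Implicit Arguments.
Unset Strict Implicit.
Unset Printing Implicit Defensive.

Import Order.TTheory GRing.Theory Num.Theory.
Import numFieldNormedType.Exports.

Local Open Scope classical_set_scope.
Local Open Scope ring_scope.

(* Nonemptiness is explicit because [perfect_set set0] holds. *)
Definition cantor_set {T : ptopologicalType} (A : set T) : Prop :=
  [/\ A !=set0, compact A, totally_disconnected A & perfect_set A].

(* The library norm on [R * R] is the max norm, hence this definition. *)
Definition euclidean_dist {R : realType} (p q : R * R) : R :=
  Num.sqrt ((p.1 - q.1) ^+ 2 + (p.2 - q.2) ^+ 2).

(* [ucycle] also accepts the cycles [:: x; y] that run back and forth along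
   one edge, so only cycles with at least three vertices are excluded. *)
Record rooted_tree := RootedTree {
  vertex :> finType;
  adj : rel vertex;
  root : vertex;
  adj_sym : symmetric adj;
  adj_irr : irreflexive adj;
  adj_connected : forall u v : vertex, connect adj u v;
  adj_acyclic : forall c : seq vertex, ucycle adj c -> (size c < 3)%N
}.
Arguments root : clear implicits.

(* Each edge is listed once, oriented by the enumeration of the vertices. *)
Definition edge_seq (T : rooted_tree) : seq (T * T) :=
  enum [pred uv : T * T |
         adj uv.1 uv.2 && (enum_rank uv.1 < enum_rank uv.2)%N].

Section EdgeCount.
Variable T : rooted_tree.
Local Notation e := (@adj T).
Local Notation r := (root T).

Let walk (v : T) n := [exists t : n.-tuple T, path e r t && (last r t == v)].

Let walk_ex v : exists n, walk v n.
Proof.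
have /connectP[p ep ->] := adj_connected r v.
exists (size p); apply/existsP; exists (in_tuple p).
by rewrite /= ep eqxx.
Qed.

Let depth v := ex_minn (walk_ex v).

Let depth_walk v : walk v (depth v).
Proof. by rewrite /depth; case: ex_minnP. Qed.

Let depth_min v n : walk v n -> (depth v <= n)%N.
Proof. by rewrite /depth; case: ex_minnP => m _; apply. Qed.

Let depth_par v : v != r -> exists u, e v u && (depth u < depth v)%N.
Proof.
move=> vr; have /existsP[[t /= /eqP st] /andP[]] := depth_walk v.
case/lastP: t st => [|p w] st /=; first by rewrite eq_sym (negPf vr).
rewrite rcons_path last_rcons => /andP[ep ew] /eqP wv.
exists (last r p); rewrite adj_sym -wv ew wv -st size_rcons ltnS.
by apply: depth_min; apply/existsP; exists (in_tuple p); rewrite /= ep eqxx.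
Qed.

Let par v := odflt v [pick u | e v u && (depth u < depth v)%N].

Let parP v : v != r -> e v (par v) /\ (depth (par v) < depth v)%N.
Proof.
move=> /depth_par[u hu]; rewrite /par; case: pickP => [w /andP[]//|].
by move=> /(_ u); rewrite hu.
Qed.

Let e' : rel T := fun u v => ((u != r) && (v == par u)) || ((v != r) && (u == par v)).

Let e'_sub : subrel e' e.
Proof.
move=> u v /orP[] /andP[/parP[h _] /eqP ->] //.
by rewrite adj_sym.
Qed.

Let e'_sym : connect_sym e'.
Proof. by apply: sym_connect_sym => u v; rewrite /e' orbC. Qed.

Let e'_root v : connect e' v r.
Proof.
have [n] := ubnP (depth v); elim: n v => // n IH v dv.
have [->|vr] := eqVneq v r; first exact: connect0.
have [_ dp] := parP vr.
apply: (@connect_trans _ _ (par v)); last exact: IH (leq_trans dp dv).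
by apply: connect1; rewrite /e' vr eqxx.
Qed.

Let e_e' u v : e u v -> e' u v.
Proof.
move=> euv; apply/negPn/negP => ne'.
have : connect e' u v.
  by apply: (connect_trans (e'_root u)); rewrite e'_sym e'_root.
case/connectP => p0 ep0 vE.
have {ep0 vE} [p [ep vE up]] :
    exists p, [/\ path e' u p, v = last u p & uniq (u :: p)].
  by exists (shorten u p0); move: vE; case: (shortenP ep0) => p -> -> _ ->.
have : ucycle e (u :: p).
  apply/andP; split=> //=; rewrite rcons_path (sub_path e'_sub ep) /=.
  by rewrite -vE adj_sym.
move/adj_acyclic; case: p ep vE {up} => [|w [|]] //=.
- by move=> _ vE; move: euv; rewrite vE adj_irr.
- by rewrite andbT => e'w vE; move: ne'; rewrite vE e'w.
Qed.

Let orient (u v : T) := if (enum_rank u < enum_rank v)%N then (u, v) else (v, u).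

Let orientP u v u' v' : orient u v = orient u' v' ->
  (u = u' /\ v = v') \/ (u = v' /\ v = u').
Proof. by rewrite /orient; do 2![case: ifP => _] => -[-> ->]; auto. Qed.

Let orient_edge u v : e u v -> orient u v \in edge_seq T.
Proof.
move=> euv; rewrite mem_enum inE /orient; case: ltnP => /= h; first by rewrite euv.
rewrite adj_sym euv /= ltn_neqAle h andbT; apply/negP => /eqP/val_inj.
by move/enum_rank_inj => vu; move: euv; rewrite vu adj_irr.
Qed.

Lemma size_edge_seq : size (edge_seq T) == #|T|.-1.
Proof.
rewrite -cardE; apply/eqP.
transitivity #|[set~ r]%SET|; last by rewrite cardsC1.
rewrite -[RHS](card_in_imset (f := fun v => orient v (par v))); last first.
  move=> u v; rewrite !inE => ur vr /orientP[[]//|[uE vE]].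
  have [_ du] := parP ur; have [_ dv] := parP vr.
  by move: dv; rewrite -uE => dv; move: du; rewrite vE ltnNge (ltnW dv).
apply: eq_card => -[u v]; apply/idP/imsetP => [uvE|[w]]; last first.
  by rewrite !inE => /parP[ew _] wE; move: (orient_edge ew); rewrite -wE mem_enum.
move: uvE; rewrite inE /= => /andP[/e_e' /orP[] /andP[h /eqP hE] lt_uv].
- by exists u; rewrite ?inE // -hE /orient lt_uv.
- by exists v; rewrite ?inE // -hE /orient ltnNge (ltnW lt_uv).
Qed.

End EdgeCount.

Definition edges (T : rooted_tree) : (#|T|.-1).-tuple (T * T) :=
  Tuple (size_edge_seq T).

Definition pinned_tree_distances {R : realType} (T : rooted_tree)
    (X : set (R * R)) (y : R * R) : set 'rV[R]_(#|T|.-1) :=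
  [set z | exists p : T -> R * R,
     [/\ injective p, forall v, X (p v), p (root T) = y &
         z = \row_i euclidean_dist (p (tnth (edges T) i).1)
                                   (p (tnth (edges T) i).2)]].
Arguments pinned_tree_distances {R} T X y.

(* Main.v *)
Require Import Defs.
From mathcomp Require Import all_boot all_order all_algebra.
From mathcomp Require Import all_classical all_reals all_analysis.
From mathcomp Require Import ring lra.
Set Implicit Arguments.
Unset Strict Implicit.
Unset Printing Implicit Defensive.
Import Order.TTheory GRing.Theory Num.Theory.
Import numFieldNormedType.Exports.
Local Open Scope classical_set_scope.
Local Open Scope ring_scope.

(** The Cantor set [K] may be arbitrarily thin, so no thickness argument can
    apply to it; instead the second factor is built to suit [K].

    Two facts make this possible. First, a compact perfect set cannot be kept
    away from the complement of sufficiently small gaps: if [f] is expanding on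
    a piece of [K] (distances are multiplied by at least [kappa]), then among
    two well-separated sub-pieces of [K], one has an image that misses a given
    short gap, and repeating this for gaps [U 0], [U 1], and so on produces a
    point [x] of [K] with [f x] outside all of them
    ([perfect_avoids_small_sets]). The admissible gap lengths depend on [K],
    [kappa] and the size of the piece, not on its position nor on [f]. Secondly, gaps of prescribed lengths can be
    dug around a dense sequence, with disjoint closures, so that the closed set
    [M] left over is perfect and contains no interval
    ([perfect_complement_of_gaps]). Thus a single [M], essentially a Cantor
    set, meets the image of every piece of [K] under every [kappa]-expanding
    map.

    This is applied to the upper arcs of circles. Given a point [(a, b)] and a
    radius [t] larger than the diameter of [K], the points at distance [t]
    above it are [(x, h x)] with [h x = b + sqrt (t ^ 2 - (x - a) ^ 2)], and
    [h] is expanding on any piece of [K] lying at a positive distance from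
    [a], with a constant independent of [b] ([circle_height_expanding]). So if
    each vertex [v] of the tree has its own piece of [K], centred at [c v] and
    separated from the others, then from a point above the piece of [u] and for
    a neighbour [v] of [u], every distance [t] in a fixed interval is realised
    by a point of [K * M] above the piece of [v]. Walking through the tree from
    the root realises all prescriptions of edge lengths in an open box
    ([tree_greedy_realization]); acyclicity is what makes a new vertex subject
    to one constraint only, and separation of the pieces makes the points
    distinct. All heights that occur stay within a bounded distance of the
    root's, hence [M] may be cut down to a compact set. *)

(** * Perfect sets and small gaps *)

(** Perfectness only gives other points of [K] close to each [x]; compactness
    yields the uniform lower bound [d], since a point [w] that serves for [z] at
    distance [`|z - w|] serves near [z] at half that distance. *)
Lemma perfect_uniform_neighbours (R : realType) (K : set R) (eta : R) :
  compact K -> perfect_set K -> 0 < eta ->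
  exists2 d : R, 0 < d & forall x, K x ->
    exists y, [/\ K y, d <= `|x - y| & `|x - y| <= eta].
Proof.
move=> cptK [_ limK] eta_gt0.
have : \forall d \near 0^'+, K `<=`
    [set x | exists y, [/\ K y, d <= `|x - y| & `|x - y| <= eta]].
  move: (cptK) => /compact_near_coveringP; apply => z Kz.
  have [w [/eqP wz Kw /= zw]] : exists w, [/\ w != z, K w & `|z - w| < eta / 2].
    rewrite -limK in Kz; case: (Kz (ball z (eta / 2))) => [|w [? ? ?]].
      by apply: nbhsx_ballx; rewrite divr_gt0.
    by exists w.
  have zw_gt0 : 0 < `|z - w| by rewrite normr_gt0 subr_eq0 eq_sym; apply/eqP.
  near=> x d; exists w.
  have xz : `|z - x| < `|z - w| / 2.
    near: x; apply: nbhsx_ballx; rewrite divr_gt0//.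
  have dzw : d < `|z - w| / 2.
    by near: d; apply: nbhs_right_lt; rewrite divr_gt0.
  have h1 := ler_distD x z w; have h2 := ler_distD z x w.
  rewrite (distrC x z) in h2.
  by split => //=; lra.
case=> e /= e_gt0 he; exists (e / 2); first by rewrite divr_gt0.
apply: he; last by rewrite /= divr_gt0.
by rewrite /= sub0r normrN gtr0_norm ?divr_gt0//; lra.
Unshelve. all: by end_near. Qed.

(** If [eta'] is the new radius, the centres [c] and [y] are four radii apart, so
    that points of the two sub-balls remain two radii apart. *)
Lemma perfect_split_balls (R : realType) (K : set R) (eta : R) :
  compact K -> perfect_set K -> 0 < eta ->
  exists2 eta' : R, 0 < eta' & forall c, K c -> exists y,
    [/\ K y, `|c - y| + eta' <= eta & 4 * eta' <= `|c - y|].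
Proof.
move=> cptK pK eta_gt0.
have [|d d_gt0 dP] := perfect_uniform_neighbours (eta := eta / 2) cptK pK.
  by rewrite divr_gt0.
exists (d / 4); first by rewrite divr_gt0.
move=> c /dP[y [Ky dcy cy]]; exists y; split => //; lra.
Qed.

(** The argument is a descent in [K]: the ball around the current centre splits
    into the balls around two far apart points, whose images under [f] are too
    far apart for both to meet the next small set. The radii come from the
    uniform splitting of [K], hence [eps] is chosen before [c], [f] and [U]. *)
Lemma perfect_avoids_small_sets (R : realType) (K : set R) (rho kappa : R) :
  compact K -> perfect_set K -> 0 < rho -> 0 < kappa ->
  exists2 eps : nat -> R, (forall n, 0 < eps n) &
    forall U : nat -> set R,
      (forall n u v, U n u -> U n v -> `|u - v| < eps n) ->
    forall (c : R) (f : R -> R), K c ->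
      (forall x y, K x -> K y -> `|x - c| <= rho -> `|y - c| <= rho ->
        kappa * `|x - y| <= `|f x - f y|) ->
    exists x, [/\ K x, `|x - c| <= rho & forall n, ~ U n (f x)].
Proof.
move=> cptK pK rho_gt0 kappa_gt0.
have /choice[d dP] : forall eta : R, exists eta', 0 < eta -> 0 < eta' /\
    forall c, K c -> exists y,
    [/\ K y, `|c - y| + eta' <= eta & 4 * eta' <= `|c - y|].
  move=> eta; have [eta_gt0|?] := boolP (0 < eta); last by exists 0.
  by have [e e0 eP] := perfect_split_balls cptK pK eta_gt0; exists e.
pose eta n := iter n d rho.
have etaS n : eta n.+1 = d (eta n) by [].
have eta_gt0 n : 0 < eta n by elim: n => //= n /dP[].
exists (fun n => kappa * eta n.+1) => [n|U U_small c f Kc f_exp].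
  by rewrite mulr_gt0.
(* [g (n, x)] is the centre of the sub-ball, of radius [eta n.+1], of the ball
   of radius [eta n] around [x] whose image misses [U n]. *)
have /choice[g gP] : forall p : nat * R, exists x',
    K p.2 -> `|p.2 - c| + eta p.1 <= rho ->
    [/\ K x', `|p.2 - x'| + eta p.1.+1 <= eta p.1 &
        forall u, K u -> `|u - x'| <= eta p.1.+1 -> ~ U p.1 (f u)].
  move=> [n x] /=; rewrite -etaS.
  have [[Kx xc]|nKx] := pselect (K x /\ `|x - c| + eta n <= rho); last first.
    by exists 0 => Kx xc; case: nKx.
  have [_ /(_ x Kx)[y [Ky xy xy_far]]] := dP _ (eta_gt0 n).
  have eta'_gt0 := eta_gt0 n.+1.
  rewrite -etaS in xy xy_far.
  have [miss|hit] := pselect (forall u, K u -> `|u - x| <= eta n.+1 -> ~ U n (f u)).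
    exists x => _ _; split => //; rewrite subrr normr0 add0r.
    by have := normr_ge0 (x - y); lra.
  exists y => _ _; split => // v Kv vy Uv; apply: hit => u Ku ux Uu.
  have uv := ler_distD u x v; have vy' := ler_distD v x y.
  have uc := ler_distD x u c; have vc := ler_distD y v c.
  have yc := ler_distD x y c.
  rewrite (distrC x u) in uv; rewrite (distrC y x) in yc.
  have : kappa * `|u - v| <= `|f u - f v| by apply: f_exp => //; lra.
  have := U_small _ _ _ Uu Uv.
  have : kappa * eta n.+1 <= kappa * `|u - v| by apply: ler_wpM2l; lra.
  lra.
pose xs := fix xs n := if n is m.+1 then g (m, xs m) else c.
have xsP n : K (xs n) /\ `|xs n - c| + eta n <= rho.
  elim: n => [|n [Kx xc]] /=; first by rewrite subrr normr0 add0r.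
  have [/= Kx' xx' _] := gP (n, xs n) Kx xc.
  have := ler_distD (xs n) (g (n, xs n)) c; rewrite (distrC _ (xs n)).
  by move=> ?; split => //; lra.
have xs_step n : `|xs n - xs n.+1| + eta n.+1 <= eta n.
  by have [Kx xc] := xsP n; have [] := gP (n, xs n) Kx xc.
have xs_miss n u : K u -> `|u - xs n.+1| <= eta n.+1 -> ~ U n (f u).
  by have [Kx xc] := xsP n; have [_ _] := gP (n, xs n) Kx xc; exact.
have xs_near n k : `|xs n - xs (n + k)%N| + eta (n + k)%N <= eta n.
  elim: k => [|k IH]; first by rewrite addn0 subrr normr0 add0r.
  rewrite addnS; have := xs_step (n + k)%N.
  have := ler_distD (xs (n + k)%N) (xs n) (xs (n + k).+1); lra.
have [|x [Kx clx]] := cptK (xs @ \oo) _.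
  by exists 0%N => // n _; have [] := xsP n.
have xs_lim n : `|x - xs n| <= eta n.
  apply/ler_addgt0Pr => e e_gt0.
  have [||_ [[k nk <-] /= xk]] :=
    clx [set xs k | k in [set k | (n <= k)%N]] (ball x e).
  - by exists n => // k /= nk; exists k.
  - exact: nbhsx_ballx.
  have := xs_near n (k - n)%N; rewrite subnKC//.
  have := ler_distD (xs k) x (xs n); rewrite (distrC (xs k) (xs n)).
  have := eta_gt0 k; move: xk; rewrite /ball /=; lra.
exists x; split => //.
- exact: xs_lim 0%N.
- by move=> n; apply: xs_miss.
Qed.

(** * A perfect set left over by small gaps *)

Lemma exists_dense_sequence (R : realType) :
  exists q : nat -> R, forall x y, x < y -> exists n, x < q n < y.
Proof.
exists (fun n => oapp ratr 0 (unpickle n : option rat)) => x y /rat_in_itvoo[p].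
by rewrite in_itv /= => hp; exists (pickle p); rewrite pickleK.
Qed.

(** Gaps are dug one after the other around the points [q n]. A point that lies
    in the closure of an earlier gap gets the radius [0], that is, an empty open
    gap; any other point has a positive distance to the finitely many earlier
    closed gaps, which leaves room for a new one with disjoint closure. *)
Lemma disjoint_gap_radii (R : realType) (eps q : nat -> R) :
  (forall n, 0 < eps n) ->
  exists r : nat -> R, forall n, r n < eps n /\
    (r n = 0 /\ (exists2 k, 0 < r k & `|q n - q k| <= r k) \/
     0 < r n /\ forall k, (k < n)%N -> 0 < r k -> r k + r n < `|q n - q k|).
Proof.
move=> eps_gt0.
pose covered (n : nat) (r : nat -> R) :=
  exists k, [/\ (k < n)%N, 0 < r k & `|q n - q k| <= r k].
have /choice[g gP] : forall p : nat * (nat -> R), exists v, v < eps p.1 /\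
    (v = 0 /\ covered p.1 p.2 \/
     0 < v /\ forall k, (k < p.1)%N -> 0 < p.2 k ->
       p.2 k + v < `|q p.1 - q k|).
  move=> [n r] /=; have [cov|ncov] := pselect (covered n r).
    by exists 0; split => //; left.
  have : \forall v \near 0^'+, [/\ 0 < v, v < eps n & forall k : 'I_n,
      0 < r k -> r k + v < `|q n - q k|].
    near=> v; split.
    - by near: v; exact: nbhs_right_gt.
    - by near: v; exact: nbhs_right_lt.
    - near: v; apply: filter_forall => k.
      have [rk_le0|rk_gt0] := leP (r k) 0.
        by near=> v.
      near=> v; move=> _; rewrite addrC -ltrBrDr; near: v.
      apply: nbhs_right_lt; rewrite subr_gt0 ltNge; apply/negP => hk.
      by apply: ncov; exists k; split.
  move=> /filter_ex[v [v0 veps hv]]; exists v; split => //; right; split => // k kn.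
  exact: (hv (Ordinal kn)).
(* [s n] lists the first [n] radii, and is [0] at the other indices. *)
pose s := fix s n : nat -> R :=
  if n is m.+1 then fun k => if k == m then g (m, s m) else s m k
  else fun=> 0.
pose r n := s n.+1 n.
have sE m k : (k < m)%N -> s m k = r k.
  elim: m => // m IH; rewrite ltnS leq_eqVlt => /orP[/eqP -> //|km] /=.
  by rewrite (ltn_eqF km) IH.
exists r => n; have := gP (n, s n).
have -> : g (n, s n) = r n by rewrite /r /= eqxx.
move=> /= [? [[rn [k [kn sk cov]]]|[rn hn]]]; split => //.
- by left; split => //; exists k; rewrite -(sE n k kn).
- by right; split => // k kn; rewrite -(sE n k kn); exact: hn.
Unshelve. all: by end_near. Qed.

(** Disjointness of the closed gaps is what makes the complement perfect: the
    endpoints of gaps belong to it and accumulate on both sides of a point [z],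
    unless [z] itself is an endpoint; and [z] cannot be the left endpoint of one
    gap and the right endpoint of another. *)
Lemma perfect_complement_of_gaps (R : realType) (eps : nat -> R) :
  (forall n, 0 < eps n) ->
  exists U : nat -> set R,
    [/\ forall n u v, U n u -> U n v -> `|u - v| < eps n,
        perfect_set (~` \bigcup_n U n) &
        forall x y, x < y -> exists2 z, x < z < y & (\bigcup_n U n) z].
Proof.
move=> eps_gt0; have [q q_dense] := exists_dense_sequence R.
have [n|r rP] := @disjoint_gap_radii R (fun n => eps n / 2) q.
  by rewrite divr_gt0.
have r_lt n : r n < eps n / 2 by have [] := rP n.
have covered n : exists2 k, 0 < r k & `|q n - q k| <= r k.
  have [_ [[_ //]|[rn _]]] := rP n.
  by exists n => //; rewrite subrr normr0 ltW.
have disj j k : 0 < r j -> 0 < r k -> j <> k -> r j + r k < `|q j - q k|.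
  wlog jk : j k / (k < j)%N.
    move=> wl rj rk; case: (ltngtP j k) => // jk _.
    - by rewrite addrC distrC; apply: wl => // kj; move: jk; rewrite kj ltnn.
    - by apply: wl => // kj; move: jk; rewrite kj ltnn.
  move=> rj rk _; have [_ [[rj0 _]|[_ /(_ _ jk rk)]]] := rP j.
    by move: rj; rewrite rj0 ltxx.
  by rewrite addrC.
pose U n := [set x | `|x - q n| < r n].
have endpoint k x : 0 < r k -> `|x - q k| = r k -> (~` \bigcup_n U n) x.
  move=> rk xk [j _ xj].
  have {}xj : `|x - q j| < r j := xj.
  have rj : 0 < r j by apply: le_lt_trans xj.
  have [jk|jk] := pselect (j = k); first by move: xj; rewrite jk xk ltxx.
  have := disj _ _ rj rk jk; have := ler_distD x (q j) (q k).
  by rewrite (distrC (q j) x); lra.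
exists U; split.
- move=> n u v un vn; rewrite /U /= in un vn; have := ler_distD (q n) u v.
  by rewrite (distrC (q n) v); have := r_lt n; lra.
- split.
    rewrite closedC; apply: bigcup_open => n _.
    rewrite (_ : U n = ball (q n) (r n)); first exact: ball_open.
    by apply/seteqP; split => x; rewrite /ball /= distrC.
  apply/seteqP; split => [x|z Mz].
    apply: contraPP => /contrapT[n _ Un] /(_ (U n))[|y [_ nUy Uy]].
      rewrite (_ : U n = ball (q n) (r n)).
        by apply: open_nbhs_nbhs; split; [exact: ball_open|rewrite /ball /= distrC].
      by apply/seteqP; split => y; rewrite /ball /= distrC.
    by apply: nUy; exists n.
  move=> V /nbhs_ballP[e /= e_gt0 zV].
  suff [y [yz My ze]] : exists y, [/\ y <> z, (~` \bigcup_n U n) y & `|z - y| < e].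
    by exists y; split => //; [exact/eqP|exact: zV].
  have outside k : r k <= `|z - q k|.
    by rewrite leNgt; apply/negP => zk; apply: Mz; exists k.
  (* To the right of [z]: the left endpoint of the gap near [q n], or [z]
     itself is this endpoint. *)
  have [|n /andP[zn ne]] := q_dense z (z + e); first by rewrite ltrDl.
  have [k rk nk] := covered n.
  have zk : z <= q k - r k.
    have := outside k; move: nk; rewrite ler_norml => /andP[nk1 nk2].
    by case: (lerP (q k) z); lra.
  have [zk'|zk'] := pselect (z = q k - r k); last first.
    exists (q k - r k); split; first by move=> h; apply: zk'.
      by apply: (endpoint k) => //; rewrite addrAC subrr sub0r normrN gtr0_norm.
    move: nk; rewrite ler_norml => /andP[nk1 nk2].
    by rewrite distrC ger0_norm; lra.
  (* The same to the left of [z]. *)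
  have [|m /andP[me mz]] := q_dense (z - e) z; first by rewrite gtrBl.
  have [j rj mj] := covered m.
  have zj : q j + r j <= z.
    have := outside j; move: mj; rewrite ler_norml => /andP[nk1 nk2].
    by case: (lerP (q j) z); lra.
  have [zj'|zj'] := pselect (z = q j + r j); last first.
    exists (q j + r j); split; first by move=> h; apply: zj'.
      by apply: (endpoint j) => //; rewrite addrAC subrr add0r gtr0_norm.
    move: mj; rewrite ler_norml => /andP[nk1 nk2].
    by rewrite ger0_norm; lra.
  have /(disj _ _ rj rk) : j <> k.
    by move=> jk; move: zj' zk'; rewrite jk; lra.
  by rewrite ltr0_norm; lra.
- move=> x y xy; have [n /andP[xn ny]] := q_dense _ _ xy.
  have [k rk] := covered n; rewrite ler_norml => /andP[nk1 nk2].
  have [|m /andP[h1 h2]] := q_dense (Num.max x (q k - r k)) (Num.min y (q k + r k)).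
    by rewrite gt_max !lt_min; lra.
  move: h1 h2; rewrite gt_max lt_min => /andP[xm km] /andP[my mk].
  exists (q m); first by rewrite xm.
  by exists k => //; rewrite /U /= ltr_norml; apply/andP; split; lra.
Qed.

(** Cutting at points outside [M] creates no isolated endpoint: the closed and
    the open interval between them have the same trace on [M]. *)
Lemma truncate_to_cantor_set (R : realType) (M : set R) (x0 a b : R) :
  perfect_set M ->
  (forall x y, x < y -> exists2 z, x < z < y & (~` M) z) ->
  M x0 -> a <= x0 <= b ->
  exists2 C : set R, cantor_set C & [set x | M x /\ a <= x <= b] `<=` C.
Proof.
move=> [clM limM] holes Mx0 /andP[ax0 x0b].
have [|a' /andP[_ aa'] Ma'] := holes (a - 1) a; first by lra.
have [|b' /andP[bb' _] Mb'] := holes b (b + 1); first by lra.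
pose C := M `&` `[a', b'].
have CE : C = M `&` `]a', b'[.
  apply/seteqP; split => x [Mx]; rewrite /= !in_itv /= => /andP[ax xb]; split => //=.
    rewrite !lt_neqAle ax xb !andbT.
    by apply/andP; split; apply/negP => /eqP ex; [apply: Ma'|apply: Mb'];
      rewrite ?ex// -ex.
  by rewrite in_itv /= !ltW.
exists C; last first.
  by move=> x [Mx /andP[ax xb]]; split => //=; rewrite in_itv /=; lra.
split.
- by exists x0; split => //=; rewrite in_itv /=; lra.
- by rewrite /C setIC; apply: compact_closedI => //; exact: segment_compact.
- move=> x Cx; apply/seteqP; split => [y [E [Ex EC cE] Ey]|_ ->]; last first.
    exact: connected_component_refl.
  have {}cE : is_interval E by exact/connected_intervalP.
  apply: contrapT => yx.
  have [u [v [uv Eu Ev]]] : exists u v, [/\ u < v, E u & E v].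
    by have [xy|xy|xy] := ltgtP x y; [exists x, y|exists y, x|case: yx].
  have [z /andP[uz zv]] := holes _ _ uv; apply.
  by have [] := EC z (cE _ _ Eu Ev z (introT andP (conj (ltW uz) (ltW zv)))).
- have clC : closed C by apply: closedI => //; exact: interval_closed.
  split => //.
  apply/seteqP; split => [x xC|x].
    exact/clC/subset_limit_point.
  rewrite CE => -[Mx xab] V Vx.
  have [y [yx My [Vy yab]]] : exists y, [/\ y != x, M y & (V `&` `]a', b'[) y].
    rewrite -limM in Mx; apply: Mx.
    by apply: filterI => //; exact: near_in_itvoo.
  by exists y; split.
Qed.

(** * Trees *)

(** Otherwise [w], together with a simple path inside [S] from [u] to [u'],
    would form a cycle. *)
Lemma tree_attaching_vertex_unique (T : rooted_tree) (S : {set T}) (u u' w : T) :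
  connect [rel x y | [&& adj x y, x \in S & y \in S]] u u' ->
  u \in S -> w \notin S -> adj u w -> adj u' w -> u = u'.
Proof.
set e := [rel x y | _] => uu' uS wS uw u'w.
have closedS : fingraph.closed e (mem S).
  by move=> x y /and3P[_ xS yS]; rewrite /= xS yS.
case/connectP: uu' => p0 ep0 u'E.
have [p [ep {}u'E up]] :
    exists p, [/\ path e u p, u' = last u p & uniq (u :: p)].
  by exists (shorten u p0); move: u'E; case: (shortenP ep0) => p -> -> _ ->.
have : ucycle (@adj T) (w :: u :: p).
  apply/andP; split.
    rewrite /= rcons_path adj_sym uw -u'E u'w andbT /=.
    by apply: (sub_path _ ep) => x y /and3P[].
  rewrite cons_uniq up andbT; apply: contra wS => wp.
  by have <- := closed_connect closedS (path_connect ep wp).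
by move/adj_acyclic; case: p {ep up} u'E.
Qed.

(** The placement [p] is extended one vertex at a time, over vertex sets [S] that
    are connected and contain the root; the new vertex has a single neighbour in
    [S], hence the one-edge extension property suffices. *)
Lemma tree_greedy_realization (T : rooted_tree) (X : Type) (P : T -> X -> Prop)
    (E : T -> T -> X -> X -> Prop) (x0 : X) :
  (forall u v x y, E u v x y -> E v u y x) ->
  (forall u v x, adj u v -> P u x -> exists2 y, P v y & E u v x y) ->
  P (Defs.root T) x0 ->
  exists p : T -> X, [/\ p (Defs.root T) = x0, forall v, P v (p v) &
    forall u v, adj u v -> E u v (p u) (p v)].
Proof.
move=> Esym extend Px0.
pose e (S : {set T}) := [rel x y : T | [&& adj x y, x \in S & y \in S]].
have eC S : connect_sym (e S).
  by apply: sym_connect_sym => x y; rewrite /e /= adj_sym andbA andbAC -andbA.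
have grow n : (n < #|T|)%N -> exists (S : {set T}) (p : T -> X),
    [/\ #|S| = n.+1, Defs.root T \in S, forall v, v \in S -> connect (e S) (Defs.root T) v,
        p (Defs.root T) = x0 & (forall v, v \in S -> P v (p v)) /\
        (forall u v, u \in S -> v \in S -> adj u v -> E u v (p u) (p v))].
  elim: n => [|n IH] nT.
    exists [set Defs.root T]%SET, (fun=> x0); split => //.
    - by rewrite cards1.
    - by rewrite inE.
    - by move=> v; rewrite inE => /eqP ->; exact: connect0.
    - split=> [v|u v]; rewrite inE => /eqP -> //.
      by rewrite inE => /eqP ->; rewrite adj_irr.
  have [S [p [cardS rS conS pr [PS ES]]]] := IH (ltnW nT).
  have [u [w [uS wS uw]]] : exists u w, [/\ u \in S, w \notin S & adj u w].
    apply: contrapT => no; move: nT; rewrite -cardS ltnNge => /negP; apply.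
    rewrite -cardsT; apply: subset_leq_card; apply/fintype.subsetP => v _.
    have adjC : connect_sym (@adj T) by exact/sym_connect_sym/adj_sym.
    have cl : fingraph.closed (@adj T) (mem S).
      apply: intro_closed => // x y xy xS; apply/negPn/negP => yS.
      by apply: no; exists x, y.
    by have /= <- := closed_connect cl (adj_connected (Defs.root T) v).
  have [y Py Ey] := extend _ _ _ uw (PS _ uS).
  have uniq_nbr v : v \in S -> adj v w -> v = u.
    move=> vS vw; apply/esym/(tree_attaching_vertex_unique (S := S) (w := w)) => //.
    by apply: connect_trans (conS _ vS); rewrite eC conS.
  have S_neq_w v : v \in S -> (v == w) = false.
    by move=> vS; apply/negbTE; apply: contraNneq wS => <-.
  have sub v : v \in S -> connect (e (w |: S)) (Defs.root T) v.
    move=> /conS; apply: connect_sub => a b /and3P[ab aS bS].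
    by apply: connect1; rewrite /e /= ab !inE aS bS !orbT.
  exists (w |: S), (fun v => if v == w then y else p v); split.
  - by rewrite cardsU1 wS cardS.
  - by rewrite !inE rS orbT.
  - move=> v; rewrite !inE => /predU1P[->|/sub //].
    apply: connect_trans (sub _ uS) (connect1 _).
    by rewrite /e /= uw !inE eqxx uS orbT.
  - by rewrite S_neq_w.
  - split=> [v|a b]; rewrite !inE.
      by move=> /predU1P[->|vS]; rewrite ?eqxx ?S_neq_w//; exact: PS.
    move=> /predU1P[->|aS] /predU1P[->|bS]; rewrite ?eqxx ?S_neq_w//.
    + by rewrite adj_irr.
    + by rewrite adj_sym => bw; rewrite (uniq_nbr b)//; exact: Esym.
    + by move=> aw; rewrite (uniq_nbr a).
    + exact: ES.
have T_gt0 : (0 < #|T|)%N by apply/card_gt0P; exists (Defs.root T).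
have [|S [p [cardS _ _ pr [PS ES]]]] := grow #|T|.-1; first by rewrite prednK.
have inS v : v \in S.
  have /eqP -> : S == [set: T]%SET by rewrite eqEcard finset.subsetT cardsT cardS prednK /=.
  by rewrite inE.
by exists p; split => // [v|u v]; [exact: PS|exact: ES].
Qed.

Lemma tree_potential_bounded (R : realType) (T : rooted_tree) (g : T -> R) (D : R) :
  0 <= D -> (forall u v, adj u v -> `|g u - g v| <= D) ->
  forall u v, `|g u - g v| <= D * #|T|%:R.
Proof.
move=> D_ge0 gD u v; have /connectP[p0 ep0 vE] := adj_connected u v.
have [p [ep {}vE up]] : exists p, [/\ path (@adj T) u p, v = last u p & uniq (u :: p)].
  by exists (shorten u p0); move: vE; case: (shortenP ep0) => p -> -> _ ->.
apply: (@le_trans _ _ (D * (size p)%:R)); last first.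
  rewrite ler_wpM2l// ler_nat; apply: ltnW.
  by have := card_uniqP up; rewrite /= => <-; exact: max_card.
rewrite vE; elim: p u ep {vE up ep0} => [|w p IH] u /=.
  by rewrite subrr normr0 mulr0.
move=> /andP[uw wp]; apply: le_trans (ler_distD (g w) _ _) _.
rewrite -natr1 mulrDr mulr1 addrC lerD//; [exact: IH|exact: gD].
Qed.

Lemma tnth_edges_adj (T : rooted_tree) (i : 'I_#|T|.-1) :
  adj (tnth (edges T) i).1 (tnth (edges T) i).2.
Proof. by have := mem_tnth i (edges T); rewrite mem_enum inE => /andP[]. Qed.

(** The orientation of the edges by the enumeration of the vertices rules out
    that [(u, v)] and [(v, u)] are both listed. *)
Lemma tnth_edges_inj (T : rooted_tree) (i j : 'I_#|T|.-1) (u v : T) :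
  tnth (edges T) i = (u, v) \/ tnth (edges T) i = (v, u) ->
  tnth (edges T) j = (u, v) \/ tnth (edges T) j = (v, u) -> i = j.
Proof.
have inj : injective (tnth (edges T)) by apply/tuple_uniqP/enum_uniq.
have lt k : (enum_rank (tnth (edges T) k).1 < enum_rank (tnth (edges T) k).2)%N.
  by have := mem_tnth k (edges T); rewrite mem_enum inE => /andP[].
have := lt i; have := lt j => + + hi hj.
by case: hi => ei; case: hj => ej; rewrite ei ej /= => h1 h2;
  apply: inj; rewrite ei ej //; move: (ltn_trans h1 h2); rewrite ltnn.
Qed.

(** * Arcs of circles over separated pieces *)

Lemma perfect_separated_points (R : realType) (K : set R) (I : finType) :
  perfect_set K -> K !=set0 ->
  exists (c : I -> R) (rho : R), [/\ 0 < rho, forall i, K (c i) &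
    forall i j, i != j -> 4 * rho <= `|c i - c j|].
Proof.
move=> [_ limK] [x0 Kx0].
have infK : infinite_set K.
  have : limit_point K x0 by rewrite limK.
  by move=> /limit_point_infinite_setP /(_ setT filterT); rewrite setTI.
have [f fK f_inj] : exists2 f : nat -> R, set_fun setT K f & set_inj setT f.
  by move/infiniteP/pcard_leP/injfunPex: infK.
pose c (i : I) := f (enum_rank i).
have c_inj i j : c i = c j -> i = j.
  by move/(f_inj _ _ (in_setT _) (in_setT _))/val_inj/enum_rank_inj.
have : \forall rho \near 0^'+, 0 < rho /\
    forall ij : I * I, ij.1 != ij.2 -> 4 * rho <= `|c ij.1 - c ij.2|.
  near=> rho; split; first by near: rho; exact: nbhs_right_gt.
  near: rho; apply: filter_forall => ij.
  have [_|ne] := eqVneq ij.1 ij.2; first exact: nearW.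
  near=> rho; move=> _; rewrite mulrC -ler_pdivlMr//; near: rho.
  apply: nbhs_right_le; rewrite divr_gt0// normr_gt0 subr_eq0.
  by apply: contra_neq ne => /c_inj.
move=> /filter_ex[rho [rho_gt0 h]]; exists c, rho; split => //.
  by move=> i; exact: fK.
by move=> i j ij; exact: (h (i, j)).
Unshelve. all: by end_near. Qed.

(** With [u] and [v] the two square roots, [u ^ 2 - v ^ 2] factors both as
    [(u - v) * (u + v)] and, up to sign, as [(x - y) * (x + y - 2 * a)]. Here
    [u + v] is at most [2 * t], while [x + y - 2 * a] is at least [4 * rho] in
    absolute value because [x] and [y] lie on the same side of [a]. *)
Lemma circle_height_expanding (R : realType) (a b c t rho x y : R) :
  3 * rho <= `|a - c| -> `|x - c| <= rho -> `|y - c| <= rho ->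
  `|x - a| < t -> `|y - a| < t ->
  2 * rho / t * `|x - y| <=
  `|(b + Num.sqrt (t ^+ 2 - (x - a) ^+ 2)) - (b + Num.sqrt (t ^+ 2 - (y - a) ^+ 2))|.
Proof.
move=> ac xc yc xa ya.
have t_gt0 : 0 < t by apply: le_lt_trans xa.
have rad_ge0 u : `|u - a| < t -> 0 <= t ^+ 2 - (u - a) ^+ 2.
  move=> ua; rewrite subr_ge0 -real_normK ?num_real// ler_sqr ?nnegrE//.
  + exact: ltW.
  + exact: ltW.
have height_le u : Num.sqrt (t ^+ 2 - (u - a) ^+ 2) <= t.
  rewrite -[leRHS]gtr0_norm// -sqrtr_sqr; apply: ler_wsqrtr.
  by rewrite gerBl sqr_ge0.
rewrite opprD addrACA subrr add0r.
have := sqr_sqrtr (rad_ge0 _ xa); have := sqr_sqrtr (rad_ge0 _ ya).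
have := height_le x; have := height_le y.
have := sqrtr_ge0 (t ^+ 2 - (x - a) ^+ 2); have := sqrtr_ge0 (t ^+ 2 - (y - a) ^+ 2).
move: (Num.sqrt (t ^+ 2 - (x - a) ^+ 2)) (Num.sqrt (t ^+ 2 - (y - a) ^+ 2)).
move=> u v v_ge0 u_ge0 vt ut v2 u2.
have factor : `|u - v| * (u + v) = `|x - y| * `|x + y - 2 * a|.
  rewrite -{1}(ger0_norm (addr_ge0 u_ge0 v_ge0)) -normrM -subr_sqr u2 v2.
  by rewrite -normrM -normrN; congr `|_|; ring.
have far : 4 * rho <= `|x + y - 2 * a|.
  have -> : x + y - 2 * a = (x - c) + (y - c) - (a - c) *+ 2 by ring.
  have h := lerB_dist ((a - c) *+ 2) ((x - c) + (y - c)).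
  rewrite normrMn distrC in h.
  have := ler_normD (x - c) (y - c); lra.
have step : `|x - y| * (4 * rho) <= `|u - v| * (2 * t).
  apply: (@le_trans _ _ (`|u - v| * (u + v))).
    by rewrite factor ler_wpM2l.
  by rewrite ler_wpM2l//; lra.
by rewrite mulrAC ler_pdivrMr//; lra.
Qed.

Lemma euclidean_dist_circle_point (R : realType) (a b x t : R) :
  `|x - a| < t ->
  euclidean_dist (a, b) (x, b + Num.sqrt (t ^+ 2 - (x - a) ^+ 2)) = t.
Proof.
move=> xa; have t_gt0 : 0 < t by apply: le_lt_trans xa.
rewrite /euclidean_dist /= opprD addrA subrr add0r sqrrN sqr_sqrtr.
  by rewrite -(opprB x) sqrrN addrC subrK sqrtr_sqr gtr0_norm.
rewrite subr_ge0 -real_normK ?num_real// ler_sqr ?nnegrE// ltW//.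
Qed.

Lemma euclidean_distC (R : realType) (p q : R * R) :
  euclidean_dist p q = euclidean_dist q p.
Proof.
by rewrite /euclidean_dist -(opprB q.1) -(opprB q.2) !sqrrN.
Qed.

(** * Distance trees in a product of Cantor sets *)

Theorem theorem2p6 (R : realType) (K : set R) (T : rooted_tree) :
  cantor_set K ->
  exists Kt : set R, cantor_set Kt /\
    exists y : R * R, (K `*` Kt) y /\
      interior (pinned_tree_distances T (K `*` Kt) y) !=set0.
Proof.
move=> [K0 cptK _ pK].
have [c [rho [rho_gt0 Kc c_sep]]] := perfect_separated_points T pK K0.
have [D D_gt0 KD] : exists2 D : R, 0 < D & forall x y, K x -> K y -> `|x - y| <= D.
  have [B [_ /(_ (`|B| + 1)) KB]] := compact_bounded cptK.
  have {}KB x : K x -> `|x| <= `|B| + 1.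
    by apply: KB; have := ler_norm B; lra.
  exists ((`|B| + 1) *+ 2); first by have := normr_ge0 B; lra.
  move=> x y /KB xB /KB yB; apply: le_trans (ler_normB _ _) _; lra.
(* Edge lengths will range over the interval from [D + 1] to [D + 2], so
   [kappa] is the worst expansion constant of the arcs. *)
pose kappa := 2 * rho / (D + 2).
have D2_gt0 : 0 < D + 2 by lra.
have kappa_gt0 : 0 < kappa by rewrite divr_gt0//; lra.
have [eps eps_gt0 avoid] := perfect_avoids_small_sets cptK pK rho_gt0 kappa_gt0.
have [U [U_small pM holes]] := perfect_complement_of_gaps eps_gt0.
set M := ~` \bigcup_n U n in pM.
have hit x f : K x ->
    (forall y z, K y -> K z -> `|y - x| <= rho -> `|z - x| <= rho ->
       kappa * `|y - z| <= `|f y - f z|) ->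
    exists y, [/\ K y, `|y - x| <= rho & M (f y)].
  move=> Kx /(avoid U U_small x f Kx)[y [Ky yx yU]].
  by exists y; split => // -[n _]; exact: yU.
have [b0 Mb0] : exists b0, M b0.
  have [x0 Kx0] := K0; have [|y [_ _ My]] := hit x0 ( *%R kappa) Kx0.
    by move=> y z _ _ _ _; rewrite -mulrBr normrM gtr0_norm.
  by exists (kappa * y).
(* Heights of adjacent vertices differ by at most [D + 2]. *)
pose B := (D + 2) * #|T|%:R.
have B_ge0 : 0 <= B by rewrite mulr_ge0//; lra.
have [||C cC MC] := @truncate_to_cantor_set R M b0 (b0 - B) (b0 + B) pM _ Mb0.
- by move=> x y /holes[z xyz Uz]; exists z => //; rewrite /M setCK.
- lra.
exists C; split => //; exists (c (Defs.root T), b0).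
have pin : (K `*` C) (c (Defs.root T), b0).
  by split => /=; [exact: Kc|apply: MC; split => //; lra].
split => //; exists (const_mx (D + 3 / 2)).
apply/nbhs_ballP; exists (1 / 2) => /=; first by lra.
move=> z zball.
have z_range i : D + 1 < z 0 i < D + 2.
  have [_ /(_ 0 i)] := zball; rewrite mxE /ball /= ltr_norml => /andP[h1 h2]; lra.
(* [P] places a vertex over its own piece of [K]; [E] prescribes the length of
   an edge and keeps the heights bounded. *)
pose P (v : T) (q : R * R) := [/\ K q.1, `|q.1 - c v| <= rho & M q.2].
pose is_edge (u v : T) i := tnth (edges T) i = (u, v) \/ tnth (edges T) i = (v, u).
pose E (u v : T) (q q' : R * R) := (forall i, is_edge u v i ->
  euclidean_dist q q' = z 0 i) /\ `|q.2 - q'.2| <= D + 2.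
have [|||p [pr Pp Ep]] := @tree_greedy_realization T _ P E (c (Defs.root T), b0).
- move=> u v q q' [qq' h]; split; last by rewrite distrC.
  by move=> i uvi; rewrite euclidean_distC; apply: qq'; case: uvi; [right|left].
- move=> u v [a b] uv [/= Ka ac Mb].
  have uv_neq : u != v by apply: contraTneq uv => ->; rewrite adj_irr.
  have [t [t_gt t_lt zt]] : exists t, [/\ D + 1 < t, t < D + 2 &
      forall i, is_edge u v i -> z 0 i = t].
    have [[i uvi]|no] := pselect (exists i, is_edge u v i).
      have /andP[? ?] := z_range i; exists (z 0 i); split => // j uvj.
      by rewrite (tnth_edges_inj uvj uvi).
    exists (D + 3 / 2); split; [lra|lra|].
    by move=> i uvi; case: no; exists i.
  have close x : K x -> `|x - a| < t by move=> Kx; have := KD _ _ Kx Ka; lra.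
  have a_far : 3 * rho <= `|a - c v|.
    have := c_sep _ _ uv_neq; have := ler_distD a (c u) (c v).
    by rewrite (distrC (c u) a); lra.
  pose h x := b + Num.sqrt (t ^+ 2 - (x - a) ^+ 2).
  have [|x [Kx xc Mx]] := hit (c v) h (Kc v).
    move=> x y Kx Ky xc yc.
    apply: le_trans (circle_height_expanding b a_far xc yc (close _ Kx) (close _ Ky)).
    rewrite ler_wpM2r// ler_wpM2l//; first lra.
    by rewrite lef_pV2 ?posrE; lra.
  exists (x, h x) => //; split => /=.
    by move=> i uvi; rewrite (zt _ uvi); exact: euclidean_dist_circle_point (close _ Kx).
  rewrite /h opprD addrA subrr add0r normrN ger0_norm ?sqrtr_ge0//.
  apply: (@le_trans _ _ t); last lra.
  rewrite -[leRHS]gtr0_norm; last lra.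
  by rewrite -sqrtr_sqr ler_wsqrtr// gerBl sqr_ge0.
- by split => //=; rewrite subrr normr0 ltW.
exists p; split => //.
- move=> u v puv; apply/eqP/negPn/negP => /c_sep uv.
  have [_ pu _] := Pp u; have [_ pv _] := Pp v; rewrite puv in pu.
  have := ler_distD (p v).1 (c u) (c v); rewrite (distrC (c u) (p v).1).
  lra.
- move=> v; have [Kv _ Mv] := Pp v; split => //; apply: MC; split => //.
  have Dp u w : adj u w -> `|(p u).2 - (p w).2| <= D + 2 by move=> /Ep[].
  have := @tree_potential_bounded R T (fun v => (p v).2) (D + 2) _ Dp v (Defs.root T).
  rewrite pr /= ler_norml -/B => /(_ (ltW D2_gt0)) /andP[]; lra.
- apply/rowP => i; rewrite mxE.
  have [/(_ i) -> //] := Ep _ _ (tnth_edges_adj i).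
  by left; case: (tnth _ _).
Qed.
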